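(* Let $G$ be a vertex transitive graph, let $\{A_t\}_{t\ge0}$ be the $G$-Cylinder-DLA process, and let $D=D_\infty$ be its density at infinity. Then $$D\le\frac23.$$
   Context: Graphs $G$ are finite, simple (no self-loops) and connected. $G$ is vertex transitive if for any $u,v\in V(G)$ there is a graph automorphism of $G$ mapping $u$ to $v$. Let $n=|G|$ be the number of vertices. $\mathbb N=\{0,1,2,\dots\}$. Cylinder: $G\times\mathbb N$ has vertex set $V(G)\times\mathbb N$, with $(u,m)\sim(v,k)$ iff either $m=k$ and $u\sim v$, or $|m-k|=1$ and $u=v$. The $i$-th layer is $G_i=V(G)\times\{i\}$. For a set $A$ of vertices of $G\times\mathbb N$, $\partial A$ is the set of vertices not in $A$ that are adjacent to some vertex of $A$. $G$-Cylinder-DLA process: a random increasing sequence $(A_t)_{t\ge 0}$ of vertex sets with $A_0=G_0$. Given $A_0,\dots,A_t$, put $M(t)=\min\{i\in\mathbb N: G_i\cap A_t=\emptyset\}$ and let $(g_{t+1}(r),\zeta_{t+1}(r))_{r\ge0}$ be a simple random walk on $G\times\mathbb N$ (each step goes to a uniformly random neighbour) with $g_{t+1}(0)$ uniform on $V(G)$ and $\zeta_{t+1}(0)=M(t)$. Let $\kappa(t+1)=\min\{r\ge0:(g_{t+1}(r),\zeta_{t+1}(r))\in\partial A_t\}$ (a.s. finite) and $A_{t+1}=A_t\cup\{(g_{t+1}(\kappa(t+1)),\zeta_{t+1}(\kappa(t+1)))\}$. Density: $A_\infty=\bigcup_{t\ge0}A_t$; $D(m)=\frac1{mn}\sum_{i=1}^m|A_\infty\cap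 G_i|$; the density at infinity is $D=D_\infty=\lim_{m\to\infty}D(m)$. By standard ergodic arguments this limit exists and is almost surely constant, so $D$ is regarded as a number, and $D=\lim_{m\to\infty}\mathbf E[D(m)]$.
   Formalization: The graph G is assumed to have at least two vertices: for the one-vertex graph every particle sticks where it starts, every layer is filled, and the density is D = 1 > 2/3, so the claim fails there. *)

(* Defs.v *)
From HB Require Import structures.
From mathcomp Require Import all_boot all_order all_algebra all_fingroup.
From mathcomp Require Import finmap.
From mathcomp Require Import all_classical all_reals all_analysis.
Set Implicit Arguments.
Unset Strict Implicit.
Unset Printing Implicit Defensive.
Import Order.TTheory GRing.Theory Num.Theory.
Import numFieldNormedType.Exports.
Local Open Scope classical_set_scope.
Local Open Scope ring_scope.

Section Cylinder.
Variables (T : finType) (e : rel T).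

Definition simple_graph : Prop := symmetric e /\ irreflexive e.

Definition connected_graph : Prop := forall u v : T, connect e u v.

Definition vertex_transitive : Prop :=
  forall u v : T, exists f : {perm T},
    (forall x y, e (f x) (f y) = e x y) /\ f u = v.

Definition cyl_adj (x y : T * nat) : bool :=
  ((x.2 == y.2) && e x.1 y.1)
  || (((x.2 == y.2.+1) || (y.2 == x.2.+1)) && (x.1 == y.1)).

Definition cyl_nbrs (x : T * nat) : set (T * nat) := [set y | cyl_adj x y].

(* [fset_set] is junk on infinite sets; this lemma rules that case out in
   [cyl_deg]. *)
Lemma finite_cyl_nbrs (x : T * nat) : finite_set (cyl_nbrs x).
Proof.
apply: (@sub_finite_set _ _ ([set: T] `*` `I_(x.2.+2))); last first.
  by apply: finite_setX; [exact: finite_finset | exact: finite_II].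
move=> [v k]; rewrite /cyl_nbrs /cyl_adj /= => h; split => //=.
case/orP: h => [/andP[/eqP <- _]|/andP[/orP[/eqP ->|/eqP ->] _]] //.
by do 2 apply: ltnW.
Qed.

Definition cyl_deg (x : T * nat) : nat := #|` fset_set (cyl_nbrs x)|.

Definition layer (i : nat) : set (T * nat) := [set x | x.2 = i].

Definition boundary (A : set (T * nat)) : set (T * nat) :=
  [set x | ~ A x /\ exists2 y, A y & cyl_adj x y].

(* The least [i] with [layer i `&` A = set0]; the default value 0 is returned
   only if [A] meets every layer, which does not happen for a DLA cluster. *)
Definition first_empty_layer (A : set (T * nat)) : nat :=
  xget 0%N [set i | layer i `&` A = set0 /\
                    forall j, (j < i)%N -> layer j `&` A <> set0].

Definition first_hit (x : nat -> T * nat) (B : set (T * nat)) (r : nat) : Prop :=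
  B (x r) /\ forall q, (q < r)%N -> ~ B (x q).

(* The cluster after aggregating a particle that follows [x].  If [x] never
   reaches the boundary (a null event for the walks below), nothing is added. *)
Definition aggregate (A : set (T * nat)) (x : nat -> T * nat) : set (T * nat) :=
  A `|` [set y | exists2 r, first_hit x (boundary A) r & y = x r].

Section Process.
Variable R : realType.

Definition srw_step (x y : T * nat) : R :=
  if cyl_adj x y then (cyl_deg x)%:R^-1 else 0.

(* Probability that the simple random walk started uniformly on layer [i]
   follows x 0, ..., x k during its first k steps. *)
Definition srw_path_prob (i k : nat) (x : nat -> T * nat) : R :=
  (if (x 0%N).2 == i then #|T|%:R^-1 else 0)
  * \prod_(r < k) srw_step (x r) (x r.+1).

Variables (d : measure_display) (Omega : measurableType d).
Variable P : probability Omega R.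

(* [X t r w] is the position after r steps of the walk (g_{t+1}, zeta_{t+1})
   that turns [A t w] into [A t.+1 w].  [DLA_walk] says that conditionally on
   A 0, ..., A t this walk is a simple random walk started uniformly on layer
   M(t); it is stated multiplicatively, which covers null conditioning events. *)
Record cylinder_DLA (X : nat -> nat -> Omega -> T * nat)
    (A : nat -> Omega -> set (T * nat)) : Prop := CylinderDLA {
  DLA_measurable : forall t r x, measurable [set w | X t r w = x];
  DLA_init : forall w, A 0%N w = layer 0;
  DLA_next : forall t w, A t.+1 w = aggregate (A t w) (fun r => X t r w);
  DLA_walk : forall (t k : nat) (a : nat -> set (T * nat)) (x : nat -> T * nat),
    let past := [set w | forall s, (s <= t)%N -> A s w = a s] in
    let walk := [set w | forall r, (r <= k)%N -> X t r w = x r] in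
    P (past `&` walk) =
      (P past * (srw_path_prob (first_empty_layer (a t)) k x)%:E)%E
}.

Definition final_cluster (A : nat -> Omega -> set (T * nat)) (w : Omega) :
  set (T * nat) := \bigcup_t A t w.

Definition layer_count (B : set (T * nat)) (i : nat) : nat :=
  #|[set v : T | `[< B (v, i) >]]|.

Definition density_upto (A : nat -> Omega -> set (T * nat)) (m : nat)
  (w : Omega) : R :=
  (m * #|T|)%:R^-1 * \sum_(1 <= i < m.+1) (layer_count (final_cluster A w) i)%:R.

(* On the one-vertex graph every particle sticks where it starts, each layer is
   filled and the density is 1; bounds below 1 need at least two vertices. *)
Definition density_at_infinity (A : nat -> Omega -> set (T * nat)) (D : R) :
  Prop := {ae P, forall w, (fun m => density_upto A m w) @ \oo --> D}.

End Process.
End Cylinder.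

(* Main.v *)
Require Import Defs.
From mathcomp Require Import all_boot all_order all_algebra all_fingroup.
From mathcomp Require Import finmap.
From mathcomp Require Import all_classical all_reals all_analysis.
From mathcomp Require Import measurable_realfun.
From mathcomp Require Import ring lra zify.
Set Implicit Arguments.
Unset Strict Implicit.
Unset Printing Implicit Defensive.
Import Order.TTheory GRing.Theory Num.Theory.
Import numFieldNormedType.Exports.
Local Open Scope classical_set_scope.
Local Open Scope ring_scope.

(** Let [n = #|T|], let [deg] be the common degree of the base graph, and call
    the first empty layer of a cluster its front.  Every particle starts
    uniformly on the front, and the front moves up (by exactly one layer)
    precisely when a particle settles on it.  The proof compares, one particle
    at a time, the chance that the particle settles at or below layer [m] with
    the chance that it moves the front.

    The front moves with conditional probability at least [3 / (2 n)]
    ([prob_front_moves]).  Fix a cluster vertex just below the front and let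
    [u] be the front vertex above it.  A particle that visits [u] before
    descending below the front fills a front vertex.  Let [w] be the
    probability of that event as a function of the starting vertex; it vanishes
    below the front, is 1 at [u], and is harmonic at all other vertices.  Since
    the base graph is regular, the sums [S_j] of [w] over the layers from the
    front upwards are affine in [j], and since they are bounded below they do
    not decrease (this is recurrence of the height of the walk).  Summing the
    harmonic equation over the front vertices other than [u] and using
    [S_0 <= S_1] gives [S_0 >= (deg + 2) / 2 >= 3 / 2]
    ([sum_hit_prob_above]), and a uniform start turns this into [S_0 / n].

    A particle settles at or below layer [m] with conditional probability at
    most [rho ^ (i - 1 - m)] when the front is at layer [i], where [rho < 1]
    depends on the base graph only ([prob_lands_below]).  Each layer below the
    front contains a cluster vertex, so on entering a layer the walk has a
    chance bounded below to run along the layer into the cluster's boundary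
    before leaving it ([hit_prob_deep]).

    Hence a particle that finds the front at layer [i] settles at or below
    layer [m] with probability at most [(2 n / 3) rho ^ (i - 1 - m)] times the
    probability that it moves the front from [i] to [i + 1].  The front leaves
    each layer at most once, so summing over all particles bounds the expected
    number of cluster vertices in layers [1], ..., [m] by
    [(2 n / 3) (m + 1 + 1 / (1 - rho))] ([sum_pr_final_cluster]).  Dividing by
    [m n] and letting [m] grow yields the bound on the density, because the
    densities of the first [m] layers lie in [0, 1] and so their means converge
    to [D]. *)

(** * The simple random walk on the cylinder and its hitting probabilities *)

Section Mean.
Context {R : realType} {I : eqType}.

Definition mean (s : seq I) (f : I -> R) : R :=
  (size s)%:R^-1 * \sum_(y <- s) f y.

Lemma mean_ge0 (s : seq I) f :
  (forall y, y \in s -> 0 <= f y) -> 0 <= mean s f.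
Proof.
move=> f0; rewrite mulr_ge0 ?invr_ge0 // big_seq.
exact: sumr_ge0.
Qed.

Lemma ler_mean (s : seq I) f g :
  (forall y, y \in s -> f y <= g y) -> mean s f <= mean s g.
Proof.
move=> fg; rewrite ler_wpM2l ?invr_ge0 // big_seq [leRHS]big_seq.
exact: ler_sum.
Qed.

Lemma mean_le (s : seq I) f c : 0 <= c ->
  (forall y, y \in s -> f y <= c) -> mean s f <= c.
Proof.
move=> c0 fc; apply: (le_trans (ler_mean fc)).
rewrite /mean big_const_seq count_predT iter_addr addr0 -(mulr_natl c) mulrA.
have [->|s0] := eqVneq (size s) 0%N; first by rewrite mulr0 mul0r.
by rewrite mulVf ?mul1r // pnatr_eq0.
Qed.

(** One neighbour whose value falls short of the common bound lowers the mean;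
    this is how a step towards the cluster is rewarded in the decay estimate. *)
Lemma mean_le_defect (s : seq I) f (y : I) c b : y \in s ->
  (forall z, z \in s -> f z <= c) -> f y <= c - b ->
  mean s f <= c - (size s)%:R^-1 * b.
Proof.
move=> ys fc fy.
have s0 : (0 < size s)%N by case: s ys {fc}.
rewrite /mean (big_rem y) //=.
have : \sum_(z <- rem y s) f z <= (size s).-1%:R * c.
  rewrite -(size_rem ys) mulr_natl -[leRHS]addr0 -iter_addr -count_predT.
  rewrite -big_const_seq big_seq [leRHS]big_seq.
  by apply: ler_sum => z /mem_rem; exact: fc.
move=> h; rewrite ler_pdivrMl ?ltr0n // mulrBr mulrA divff ?mul1r; last first.
  by rewrite pnatr_eq0 -lt0n.
have -> : (size s)%:R = (size s).-1%:R + 1 :> R by rewrite natr1 prednK.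
by rewrite mulrDl mul1r; lra.
Qed.

End Mean.

Section Neighbours.
Context {T : finType} (e : rel T).

(** On layer 0 the truncated predecessor would make a vertex its own neighbour,
    so this list is the neighbourhood only above layer 0.  The walks below are
    stopped before they step from layer 0. *)
Definition nbrs (x : T * nat) : seq (T * nat) :=
  (x.1, x.2.+1) :: (x.1, x.2.-1) :: [seq (g, x.2) | g <- enum (e x.1)].

Lemma mem_nbrs x y : (0 < x.2)%N -> (y \in nbrs x) = cyl_adj e x y.
Proof.
case: x y => [u i] [v j] /= i0; rewrite /nbrs /cyl_adj /= !inE !xpair_eqE.
have -> : ((v, j) \in [seq (g, i) | g <- enum (e u)]) = (i == j) && e u v.
  apply/mapP/andP => [[g]|[/eqP <- euv]].
    by rewrite mem_enum => eug [-> ->]; split.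
  by exists v; rewrite ?mem_enum.
rewrite (eq_sym v u); case: (u == v); case: (e u v) => /=; lia.
Qed.

Lemma nbrs_uniq x : (0 < x.2)%N -> uniq (nbrs x).
Proof.
case: x => [u i] /= i0; rewrite !inE xpair_eqE eqxx /= map_inj_uniq ?enum_uniq.
  rewrite andbT; apply/andP; split; last by apply/mapP => -[g _ []]; lia.
  rewrite negb_or; apply/andP; split; first lia.
  by apply/mapP => -[g _ []]; lia.
by move=> g h [].
Qed.

Lemma size_nbrs x : size (nbrs x) = #|e x.1|.+2.
Proof. by rewrite /= size_map -cardE. Qed.

Lemma cyl_degE x : (0 < x.2)%N -> cyl_deg e x = size (nbrs x).
Proof.
move=> x0; rewrite /cyl_deg.
have -> : fset_set (cyl_nbrs e x) = [fset y in nbrs x]%fset.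
  apply/fsetP => y; rewrite in_fset_set; last exact: finite_cyl_nbrs.
  rewrite in_fset.
  by rewrite mem_nbrs //; apply/idP/idP => [/set_mem|?]; last exact: mem_set.
rewrite card_fseq undup_id //; exact: nbrs_uniq.
Qed.

Lemma srw_stepE (R : realType) x y : (0 < x.2)%N ->
  srw_step e R x y = if y \in nbrs x then (size (nbrs x))%:R^-1 else 0.
Proof. by move=> x0; rewrite /srw_step cyl_degE // mem_nbrs. Qed.

End Neighbours.

Section HittingProbability.
Context {R : realType} {T : finType} (e : rel T).
Variables B C : pred (T * nat).

(** Probability that the walk from [x] visits [B] within [k] steps without
    having visited [C] before.  A finite horizon makes this a recursion on [k],
    so that bounds uniform in [k] are proved by plain induction. *)
Fixpoint hit_prob (k : nat) (x : T * nat) : R :=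
  if B x then 1
  else if k is k'.+1
       then if C x then 0 else mean (nbrs e x) (hit_prob k')
       else 0.

Lemma hit_prob_target k x : B x -> hit_prob k x = 1.
Proof. by case: k => [|k] /= ->. Qed.

Lemma hit_prob_avoid k x : C x -> ~~ B x -> hit_prob k x = 0.
Proof. by move=> Cx /negbTE nBx; case: k => [|k] /=; rewrite nBx ?Cx. Qed.

Lemma hit_prob_ge0 k x : 0 <= hit_prob k x.
Proof.
elim: k x => [|k IH] x /=; case: ifP => // _; case: ifP => // _.
exact: mean_ge0.
Qed.

Lemma hit_prob_le1 k x : hit_prob k x <= 1.
Proof.
elim: k x => [|k IH] x /=; case: ifP => // _; case: ifP => // _.
exact: mean_le.
Qed.

Lemma hit_prob_mono k x : hit_prob k x <= hit_prob k.+1 x.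
Proof.
elim: k x => [|k IH] x; first by rewrite /= ; case: ifP => // _;
  case: ifP => // _; apply: mean_ge0 => y _; case: ifP.
rewrite [leLHS]/= [leRHS]/=; case: ifP => // _; case: ifP => // _.
by apply: ler_mean.
Qed.

(** The event whose probability is [hit_prob], with the same recursion so that
    the two can be compared step by step. *)
Fixpoint hits (k : nat) (x : nat -> T * nat) : bool :=
  B (x 0%N) || (if k is k'.+1
                then ~~ C (x 0%N) && hits k' (fun r => x r.+1) else false).

Lemma hitsP k x : reflect
  (exists r, [/\ (r <= k)%N, B (x r) & forall q, (q < r)%N -> ~~ C (x q)])
  (hits k x).
Proof.
elim: k x => [|k IH] x /=.
  rewrite orbF; apply: (iffP idP) => [Bx|[r []]]; first by exists 0%N.
  by rewrite leqn0 => /eqP ->.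
case: (boolP (B (x 0%N))) => [Bx|nBx] /=.
  by constructor; exists 0%N.
apply: (iffP andP) => [[Cx /IH[r [rk Br Cr]]]|[[|r] [rk Br Cr]]].
- by exists r.+1; split => // -[|q]; [|exact: Cr].
- by rewrite Br in nBx.
- split; first exact: (Cr 0%N).
  by apply/IH; exists r; split => // q qr; exact: (Cr q.+1).
Qed.

End HittingProbability.

(** * Harmonic functions on the cylinder: hitting a front vertex, and deep excursions *)

Section EscapeBound.
Context {R : realType} {T : finType} (e : rel T).
Hypotheses (e_sym : symmetric e) (e_irr : irreflexive e).
Variable deg : nat.
Hypotheses (e_reg : forall v, #|e v| = deg) (deg_gt0 : (0 < deg)%N).

(** An affine sequence with negative slope eventually becomes negative.  This is
    where recurrence of the height of the walk enters. *)
Lemma affine_bounded_below_nondecreasing (S : nat -> R) :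
  (forall j, 0 <= S j) -> (forall j, S j.+2 - S j.+1 = S j.+1 - S j) ->
  S 0%N <= S 1%N.
Proof.
move=> S0 Saff; rewrite leNgt; apply/negP => S10.
have SE j : S j.+1 - S j = S 1%N - S 0%N.
  by elim: j => // j <-; exact: Saff.
have Slin j : S j = S 0%N - j%:R * (S 0%N - S 1%N).
  elim: j => [|j IH]; first by rewrite mul0r subr0.
  by rewrite -natr1; have := SE j; lra.
set b := S 0%N - S 1%N in Slin.
have b0 : 0 < b by rewrite subr_gt0.
have := archi_boundP (divr_ge0 (S0 0%N) (ltW b0)).
rewrite ltr_pdivrMr // => h.
by have := S0 (Num.bound (S 0%N / b)); rewrite Slin; lra.
Qed.

(** Horizontal steps preserve the uniform distribution on a regular graph. *)
Lemma sum_regular_nbrs (f : T -> R) :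
  \sum_v \sum_(g | e v g) f g = deg%:R * \sum_v f v.
Proof.
rewrite (exchange_big_dep xpredT) //= mulr_sumr; apply: eq_bigr => g _.
rewrite (eq_bigl (mem (e g))); last by move=> v; rewrite /= e_sym.
by rewrite sumr_const e_reg mulr_natl.
Qed.

Lemma mean_nbrsE (f : T * nat -> R) v j :
  deg.+2%:R * mean (nbrs e (v, j)) f
  = f (v, j.+1) + f (v, j.-1) + \sum_(g | e v g) f (g, j).
Proof.
rewrite /mean size_nbrs e_reg mulrA divff ?mul1r ?pnatr_eq0 //.
by rewrite !big_cons big_map big_enum /= addrA.
Qed.

Variables (u : T) (i : nat).
Hypothesis i_gt0 : (0 < i)%N.

Let target : pred (T * nat) := pred1 (u, i).
Let below : pred (T * nat) := fun x => (x.2 < i)%N.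
Let h k x : R := hit_prob e target below k x.
Let w x : R := limn (h ^~ x).

Let h_cvg x : h ^~ x @ \oo --> w x.
Proof.
have nd : nondecreasing_seq (h ^~ x).
  by apply/nondecreasing_seqP => k; exact: hit_prob_mono.
apply: (nondecreasing_is_cvgn nd); exists 1 => _ [k _ <-].
exact: hit_prob_le1.
Qed.

Let w_ge0 x : 0 <= w x.
Proof.
by apply: limr_ge; [exact: h_cvg | apply: nearW => k; exact: hit_prob_ge0].
Qed.

Let w_le1 x : w x <= 1.
Proof.
by apply: limr_le; [exact: h_cvg | apply: nearW => k; exact: hit_prob_le1].
Qed.

Let w_target : w (u, i) = 1.
Proof.
apply: (@cvg_lim R^o) => //.
rewrite (_ : h ^~ (u, i) = cst 1); first exact: cvg_cst.
by apply/funext => k; rewrite /h hit_prob_target //= /target /= eqxx.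
Qed.

Let w_below v : w (v, i.-1) = 0.
Proof.
apply: (@cvg_lim R^o) => //.
rewrite (_ : h ^~ (v, i.-1) = cst 0); first exact: cvg_cst.
apply/funext => k; rewrite /h hit_prob_avoid //= /target /below /=; first lia.
by rewrite xpair_eqE negb_and; apply/orP; right; lia.
Qed.

Let w_harmonic v j : (i <= j)%N -> (v, j) != (u, i) ->
  deg.+2%:R * w (v, j)
  = w (v, j.+1) + w (v, j.-1) + \sum_(g | e v g) w (g, j).
Proof.
move=> ij vj.
have c1 : (fun k => deg.+2%:R * h k.+1 (v, j)) @ \oo --> deg.+2%:R * w (v, j).
  apply: cvgMr; have := @h_cvg (v, j).
  by rewrite -(cvg_shiftS (h ^~ (v, j))).
have c2 : (fun k => deg.+2%:R * h k.+1 (v, j)) @ \oo -->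
    w (v, j.+1) + w (v, j.-1) + \sum_(g | e v g) w (g, j).
  rewrite (_ : (fun k => _) = fun k =>
      h k (v, j.+1) + h k (v, j.-1) + \sum_(g | e v g) h k (g, j)).
    apply: cvgD; first by apply: cvgD; exact: h_cvg.
    by apply: cvg_big => [|g _]; [exact: add_continuous | exact: h_cvg].
  apply/funext => k; rewrite {1}/h /= /target /= (negbTE vj) /below /=.
  by rewrite ltnNge ij /= -/target -/below mean_nbrsE.
exact: cvg_unique c1 c2.
Qed.

(** With [w] the limiting hitting probability and [S j] its sum over the [j]-th
    layer above layer [i], harmonicity and regularity make [S] affine for
    [j >= 0], so [S 0 <= S 1].  Summing the harmonic equation over the vertices
    [v != u] of layer [i] gives
    [(deg + 2) (S 0 - 1) = deg * S 0 - sum_(g ~ u) w (g, i) + S 1 - w (u, i + 1)],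
    and bounding the neighbour sum by [S 0 - 1] and [w (u, i + 1)] by 1 leaves
    [2 * S 0 >= deg + 2 >= 3]. *)
Lemma sum_hit_prob_above :
  exists2 S : R, 3%:R / 2%:R <= S &
    (fun k => \sum_v h k (v, i)) @ \oo --> S.
Proof.
exists (\sum_v w (v, i)); last first.
  by apply: cvg_big => [|v _]; [exact: add_continuous | exact: h_cvg].
pose S j := \sum_v w (v, (i + j)%N).
have S_ge0 j : 0 <= S j by apply: sumr_ge0.
have S_affine j : S j.+2 - S j.+1 = S j.+1 - S j.
  have : deg.+2%:R * S j.+1 = S j.+2 + S j + deg%:R * S j.+1.
    rewrite -(sum_regular_nbrs (fun v => w (v, (i + j.+1)%N))) /S mulr_sumr.
    rewrite -!big_split; apply: eq_bigr => v _ /=; rewrite w_harmonic.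
    - by rewrite !addnS.
    - by rewrite leq_addr.
    - by rewrite xpair_eqE negb_and; apply/orP; right; lia.
  by rewrite -addn2 natrD mulrDl; lra.
have S01 := affine_bounded_below_nondecreasing S_ge0 S_affine.
have S0E : S 0%N = 1 + \sum_(v | v != u) w (v, i).
  by rewrite /S addn0 (bigD1 u) //= w_target.
have S1E : S 1%N = w (u, i.+1) + \sum_(v | v != u) w (v, i.+1).
  by rewrite /S addn1 (bigD1 u).
have S_deg : deg%:R * S 0%N = \sum_(g | e u g) w (g, i)
    + \sum_(v | v != u) \sum_(g | e v g) w (g, i).
  rewrite /S addn0 -(sum_regular_nbrs (fun v => w (v, i))).
  by rewrite (bigD1 u).
have nbrs_u : \sum_(g | e u g) w (g, i) <= \sum_(v | v != u) w (v, i).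
  rewrite [leRHS](bigID (e u)) /= (eq_bigl (fun g => (g != u) && e u g)).
    by rewrite lerDl sumr_ge0.
  by move=> g; case: eqVneq => // ->; rewrite e_irr.
(* [w] vanishes one layer below, so only the upward neighbours contribute. *)
have balance : deg.+2%:R * (\sum_(v | v != u) w (v, i)) =
    \sum_(v | v != u) w (v, i.+1)
    + \sum_(v | v != u) \sum_(g | e v g) w (g, i).
  rewrite mulr_sumr -big_split; apply: eq_bigr => v vu /=.
  rewrite w_harmonic ?w_below ?addr0 // xpair_eqE negb_and vu //.
have := w_le1 (u, i.+1).
have -> : \sum_v w (v, i) = S 0%N by rewrite /S addn0.
have d1 : 1 <= deg%:R :> R by rewrite ler1n.
move: balance; rewrite -addn2 natrD; nra.
Qed.

End EscapeBound.

Section DecayBound.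
Context {R : realType} {T : finType} (e : rel T).
Variables (deg : nat) (A : set (T * nat)) (M m : nat).
Hypotheses (e_reg : forall v, #|e v| = deg) (e_conn : connected_graph e).
Hypothesis A_meets : forall j, (j < M)%N -> layer j `&` A <> set0.

Let target : pred (T * nat) := fun x => (x.2 <= m)%N.
Let stop : pred (T * nat) := fun x => `[< boundary e A x >].
Let eps : R := deg.+2%:R^-1.
Let h k x : R := hit_prob e target stop k x.

(** From any vertex of a layer that meets the cluster, some path of fewer than
    [#|T|] horizontal steps leads to the cluster, and the walk follows it with
    probability at least [(deg + 2) ^- #|T|]. *)
Definition decay_rate : R := 1 - deg.+2%:R^-1 ^+ #|T|.

Lemma decay_rate_ge0 : 0 <= decay_rate.
Proof. by rewrite subr_ge0 exprn_ile1 ?invr_ge0 // invf_le1 ?ler1n. Qed.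

Lemma decay_rate_lt1 : decay_rate < 1.
Proof. by rewrite ltrBlDr ltrDl exprn_gt0 // invr_gt0. Qed.

Let nbr_not_cluster x y : ~ A x -> ~ boundary e A x -> y \in nbrs e x ->
  (0 < x.2)%N -> ~ A y.
Proof.
move=> Ax bx yx x0 Ay; apply: bx; split=> //; exists y => //.
by rewrite -mem_nbrs.
Qed.

Let nbrs_layer x y : y \in nbrs e x -> (x.2.-1 <= y.2)%N.
Proof.
rewrite !inE => /or3P[/eqP->|/eqP->|/mapP[g _ ->]] /=; lia.
Qed.

(** If [b] bounds the probability from layer [l] upwards, then descending through
    layer [l + 1] costs a factor.  Along a horizontal path to the cluster, the
    gap to [b] shrinks by at most a factor [eps] per step, since every neighbour
    lies at height at least [l] and so is bounded by [b].  Above layer [l + 1]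
    the bound follows by averaging. *)
Let layer_step (l : nat) (b : R) : 0 <= b -> (m <= l)%N -> (l.+1 < M)%N ->
  (forall k x, ~ A x -> (l <= x.2)%N -> h k x <= b) ->
  forall k x, ~ A x -> (l.+1 <= x.2)%N -> h k x <= decay_rate * b.
Proof.
move=> b0 ml lM hb.
have e0 : 0 <= eps by rewrite invr_ge0.
have e1 : eps <= 1 by rewrite invf_le1 ?ler1n.
have on_path p v : path e v p -> A (last v p, l.+1) -> forall k, ~ A (v, l.+1) ->
    h k (v, l.+1) <= b - eps ^+ (size p) * b.
  elim: p v => [|g p IH] v /=; first by move=> _ Av k /(_ Av).
  move=> /andP[vg gp] Ap [|k] Av.
    by rewrite /h /= /target /= ltnNge ml /= subr_ge0 ler_piMl ?exprn_ile1.
  rewrite /h /= /target /= ltnNge ml /= -/target -/h; case: ifPn => /asboolP bv.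
    by rewrite subr_ge0 ler_piMl ?exprn_ile1.
  rewrite exprS -mulrA {1}/eps -(e_reg v) -[in X in X^-1](size_nbrs e (v, l.+1)).
  apply: (@mean_le_defect _ _ _ _ (g, l.+1)) => [|z zv|].
  - by rewrite mem_nbrs // /cyl_adj /= eqxx vg.
  - apply: hb; first exact: nbr_not_cluster zv _.
    exact: (nbrs_layer zv).
  - apply: IH => //; apply: (nbr_not_cluster Av bv) => //.
    by rewrite mem_nbrs // /cyl_adj /= eqxx vg.
elim=> [|k IH] [v j] /= Av jl.
  rewrite /h /= /target /= leqNgt (leq_ltn_trans ml jl) /=.
  by rewrite mulr_ge0 ?decay_rate_ge0.
have [jE|jl'] := eqVneq j l.+1.
  subst j; have [[g j] [+ Ag]] : layer l.+1 `&` A !=set0.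
    by apply/set0P/eqP; exact: A_meets.
  rewrite /layer /= => jE; subst j; have [p vp gE] := connectP (e_conn v g).
  (* A path without repeated vertices has fewer than [#|T|] steps. *)
  case/shortenP: vp gE => p' vp' p'_uniq _ gE.
  rewrite gE in Ag; apply: (le_trans (on_path _ _ vp' Ag k.+1 Av)).
  rewrite /decay_rate mulrBl mul1r lerB // ler_wpM2r // ler_wiXn2l //.
  apply: ltnW; have := max_card (mem (v :: p')).
  by rewrite (card_uniqP p'_uniq).
rewrite /h /= /target /= leqNgt (leq_ltn_trans ml jl) /= -/target -/h.
case: ifPn => /asboolP bv; first by rewrite mulr_ge0 ?decay_rate_ge0.
apply: mean_le => [|y yv]; first by rewrite mulr_ge0 ?decay_rate_ge0.
apply: IH; first by apply: (nbr_not_cluster Av bv yv); case: (j) jl.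
by apply: leq_trans (nbrs_layer yv) => /=; lia.
Qed.

(** The walk is stopped on the boundary only, and starts outside the cluster;
    since it cannot enter the cluster without crossing the boundary, starting
    points in the cluster never need to be considered. *)
Lemma hit_prob_deep l k x : (l < M)%N -> ~ A x -> (l <= x.2)%N ->
  hit_prob e target stop k x <= decay_rate ^+ (l - m).
Proof.
elim: l k x => [|l IH] k x lM Ax lx.
  by rewrite sub0n expr0; exact: hit_prob_le1.
have [lm|ml] := leqP l.+1 m.
  by rewrite (eqP lm) expr0; exact: hit_prob_le1.
rewrite subSn // exprS; apply: (layer_step (l := l)) => //.
  by rewrite exprn_ge0 ?decay_rate_ge0.
by move=> k' x' Ax' lx'; apply: IH => //; exact: ltnW.
Qed.

End DecayBound.

(** * Discrete random variables, and the law of hitting times *)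

Section DiscreteVariables.
Context {R : realType} {d : measure_display} {Omega : measurableType d}.
Variable P : probability Omega R.

Lemma measurable_discrete_preimage (I : countType) (Z : Omega -> I) (Q : set I) :
  (forall z, measurable [set w | Z w = z]) -> measurable [set w | Q (Z w)].
Proof.
move=> mZ; rewrite (_ : [set w | _] = \bigcup_z ([set w | Z w = z] `&` [set _ | Q z])).
  apply: countable_bigcupT_measurable => // z; apply: measurableI => //.
  have [Qz|Qz] := pselect (Q z).
    by rewrite (_ : [set _ | _] = setT) //; apply/seteqP; split.
  by rewrite (_ : [set _ | _] = set0) //; apply/seteqP; split.
by apply/seteqP; split => [w Qw|w [z _ [/= <-]]] //; exists (Z w).
Qed.

(** Conditional inequalities integrate: a bound that holds on each value of a
    discrete variable holds outright.  It will be applied to the history of the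
    process, which carries all conditioning. *)
Lemma measure_le_of_fibers (I : countType) (Z : Omega -> I) (E F : set Omega)
    (c : R) : (forall z, measurable [set w | Z w = z]) ->
  measurable E -> measurable F ->
  (forall z, (P (E `&` [set w | Z w = z]) <=
              c%:E * P (F `&` [set w | Z w = z]))%E) ->
  (P E <= c%:E * P F)%E.
Proof.
move=> mZ mE mF EF.
(* Coding the values by natural numbers makes the fibers a sequence. *)
pose fib n := [set w | choice.pickle (Z w) = n].
have mfib n : measurable (fib n).
  exact: (@measurable_discrete_preimage _ Z [set z | choice.pickle z = n]).
have split_measure G : measurable G -> P G = (\sum_(n <oo) P (G `&` fib n))%E.
  move=> mG; rewrite -[in LHS](setIT G) (_ : setT = \bigcup_n fib n).
    rewrite setI_bigcupr measure_bigcup //.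
    - by apply: eq_eseriesl => n; apply: mem_set.
    - by move=> n _; exact: measurableI.
    - apply/trivIsetP => i j _ _ ij; apply/seteqP.
      split=> // w [[_ /= wi] [_ /= wj]].
      by move: ij; rewrite -wi -wj eqxx.
  by apply/seteqP; split => // w _; exists (choice.pickle (Z w)).
rewrite (split_measure E) // (split_measure F) // -nneseriesZl //.
apply: lee_nneseries => // n _.
have [[z zn]|nz] := pselect (exists z : I, choice.pickle z = n).
  have -> : fib n = [set w | Z w = z]; last exact: EF.
  apply/seteqP; split => w; rewrite /fib /= -zn; last by move=> ->.
  exact: (pcan_inj choice.pickleK).
have -> : fib n = set0 by apply/seteqP; split => // w h; apply: nz; exists (Z w).
by rewrite !setI0 measure0 mule0.
Qed.

Lemma measure_sum_fibers (I : countType) (Z : Omega -> I) (s : seq I)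
    (E : set Omega) : (forall z, measurable [set w | Z w = z]) ->
  measurable E -> uniq s ->
  (forall z, z \notin s -> P (E `&` [set w | Z w = z]) = 0%E) ->
  P E = (\sum_(z <- s) P (E `&` [set w | Z w = z]))%E.
Proof.
move=> mZ mE us nul.
have mQ (Q : set I) : measurable [set w | Q (Z w)].
  exact: measurable_discrete_preimage.
have Ein : P E = P (E `&` [set w | Z w \in s]).
  rewrite -[in LHS](setIT E) -(setUv [set w | Z w \in s]) setIUr measureU.
  - rewrite [X in (_ + X)%E](_ : _ = 0%E) ?adde0 //.
    apply/eqP; rewrite eq_le measure_ge0 andbT.
    rewrite -(mul0e (P setT)); apply: (@measure_le_of_fibers _ Z) => //.
      by apply: measurableI => //; apply: measurableC; exact: (mQ [set z | z \in s]).
    move=> z; rewrite mul0e; have [zs|zs] := boolP (z \in s).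
      rewrite (_ : _ `&` _ = set0) ?measure0 //.
      by apply/seteqP; split => // w [[_ /=]] + h; rewrite h zs.
    rewrite -(nul z zs); apply: le_measure; rewrite ?inE.
    + apply: measurableI => //; apply: measurableI => //; apply: measurableC.
      exact: (mQ [set z | z \in s]).
    + exact: measurableI.
    + by move=> w [[]].
  - by apply: measurableI => //; exact: (mQ [set z | z \in s]).
  - by apply: measurableI => //; apply: measurableC; exact: (mQ [set z | z \in s]).
  - by rewrite setIACA setICr setI0.
rewrite {}Ein; elim: s us {nul} => [|z s IH] /= => [_|/andP[zs us]].
  rewrite big_nil (_ : _ `&` _ = set0) ?measure0 //.
  by apply/seteqP; split => // w [].
rewrite big_cons -(IH us) -measureU.
- congr (P _); rewrite -setIUr; congr (_ `&` _).
  apply/seteqP; split => w /=; first by rewrite in_cons => /orP[/eqP|]; auto.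
  by case=> [->|Zs]; rewrite in_cons ?eqxx // Zs orbT.
- exact: measurableI.
- by apply: measurableI => //; exact: (mQ [set z | z \in s]).
- rewrite setIACA; apply/seteqP; split => // w [_ /= [->]].
  by rewrite (negbTE zs).
Qed.

End DiscreteVariables.

Section WalkHits.
Context {R : realType} {d : measure_display} {Omega : measurableType d}.
Variable P : probability Omega R.
Context {T : finType} (e : rel T).
Variables (H : set Omega) (Y : nat -> Omega -> T * nat) (i : nat).
Hypothesis mH : measurable H.
Hypothesis mY : forall r x, measurable [set w | Y r w = x].

Let walk k (x : nat -> T * nat) :=
  [set w | forall r, (r <= k)%N -> Y r w = x r].

Hypothesis walk_law : forall k x,
  P (H `&` walk k x) = (P H * (srw_path_prob e R i k x)%:E)%E.

Variables B C : pred (T * nat).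
Hypothesis absorbed_at_bottom : forall x, ~~ B x -> ~~ C x -> (0 < x.2)%N.

Let hitsS k j w : hits B C k.+1 (fun r => Y (j + r)%N w) =
  B (Y j w) || ~~ C (Y j w) && hits B C k (fun r => Y (j.+1 + r)%N w).
Proof.
rewrite /= addn0; congr (_ || _ && hits _ _ _ _).
by apply/funext => r; rewrite addnS.
Qed.

(** The shift [j] lets the induction on [k] pass to the walk after one step. *)
Lemma measurable_hits k j :
  measurable [set w | hits B C k (fun r => Y (j + r)%N w)].
Proof.
have mQ (Q : pred (T * nat)) : measurable [set w | Q (Y j w)].
  exact: (@measurable_discrete_preimage _ _ _ (Y j) [set z | Q z]).
elim: k j mQ => [|k IH] j mQ.
  rewrite (_ : [set w | _] = [set w | B (Y j w)]) //.
  by apply/seteqP; split => w; rewrite /= orbF addn0.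
rewrite (_ : [set w | _] = [set w | B (Y j w)] `|`
  ([set w | predC C (Y j w)] `&` [set w | hits B C k (fun r => Y (j.+1 + r)%N w)])).
  apply: measurableU => //; apply: measurableI => //; apply: IH => Q.
  exact: (@measurable_discrete_preimage _ _ _ (Y j.+1) [set z | Q z]).
apply/seteqP; split => w; rewrite /mkset hitsS.
  by move=> /orP[|/andP[]]; [left | right].
by move=> [/= ->|[/= -> ->]]; rewrite ?orbT.
Qed.

Let measurable_walk k x : measurable (walk k x).
Proof.
rewrite (_ : walk k x =
   \bigcap_r ([set w | Y r w = x r] `|` [set _ | ~~ (r <= k)%N])).
  apply: bigcapT_measurable => r; apply: measurableU => //.
  by case: (r <= k)%N => /=; [rewrite (_ : [set _ | _] = set0) |
    rewrite (_ : [set _ | _] = setT)] => //; apply/seteqP; split.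
apply/seteqP; split => w /= h r.
  by move=> _; case: (boolP (r <= k)%N) => rk; [left; exact: h | right].
by move=> rk; case: (h r I) => //=; rewrite rk.
Qed.

Let extend k (x : nat -> T * nat) y r := if (r <= k)%N then x r else y.

Let walk_extend k x y :
  walk k x `&` [set w | Y k.+1 w = y] = walk k.+1 (extend k x y).
Proof.
rewrite /walk /extend; apply/seteqP; split => w /=.
  move=> [xw yw] r; rewrite leq_eqVlt ltnS => /orP[/eqP ->|rk].
    by rewrite ltnn.
  by rewrite rk; exact: xw.
move=> xw; split=> [r rk|]; last by rewrite xw // ltnn.
by rewrite xw ?rk // ltnW.
Qed.

Let path_prob_extend k x y : srw_path_prob e R i k.+1 (extend k x y) =
  srw_path_prob e R i k x * srw_step e R (x k) y.
Proof.
rewrite /srw_path_prob big_ord_recr /= mulrA /extend leqnn ltnn leq0n.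
congr (_ * _ * _); apply: eq_bigr => r _.
by rewrite ltn_ord (ltnW (ltn_ord r)).
Qed.

Let hits_after k j x :
  P (H `&` walk j x `&` [set w | hits B C k (fun r => Y (j + r)%N w)]) =
  (P H * (srw_path_prob e R i j x * hit_prob e B C k (x j))%:E)%E.
Proof.
elim: k j x => [|k IH] j x.
  rewrite /=; case: ifP => Bx.
    rewrite mulr1 -walk_law; congr (P _); apply/seteqP; split => w [] // Hw xw.
    by split => //=; rewrite orbF addn0 xw.
  rewrite mulr0 mule0 -(measure0 P); congr (P _); apply/seteqP; split => w //=.
  by move=> [[_ xw]]; rewrite orbF addn0 xw // Bx.
rewrite (_ : [set w | _] = [set w | B (Y j w) ||
    ~~ C (Y j w) && hits B C k (fun r => Y (j.+1 + r)%N w)]); last first.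
  by apply/funext => w; rewrite /mkset hitsS.
rewrite [hit_prob _ _ _ _ _]/=; case: ifP => Bx.
  rewrite mulr1 -walk_law; congr (P _); apply/seteqP; split => w [] // Hw xw.
  by split => //=; rewrite xw // Bx.
case: ifP => Cx.
  rewrite mulr0 mule0 -(measure0 P); congr (P _); apply/seteqP; split => w //=.
  by move=> [[_ xw]]; rewrite xw // Bx Cx.
have x0 : (0 < (x j).2)%N by apply: absorbed_at_bottom; rewrite ?Bx ?Cx.
set E := (X in P X).
have mE : measurable E.
  apply: measurableI; first exact: measurableI.
  rewrite (_ : mkset _ = [set w | hits B C k.+1 (fun r => Y (j + r)%N w)]).
    exact: measurable_hits.
  by apply/funext => w; rewrite /mkset hitsS.
have EE y : E `&` [set w | Y j.+1 w = y] = H `&` walk j.+1 (extend j x y) `&`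
    [set w | hits B C k (fun r => Y (j.+1 + r)%N w)].
  rewrite -walk_extend /E; apply/seteqP; split => w /=.
    by move=> [[[Hw xw]]]; rewrite xw // Bx Cx /=.
  by move=> [[Hw [xw yw]] hw]; rewrite xw // Bx Cx.
have law y : P (E `&` [set w | Y j.+1 w = y]) =
   (P H * (srw_path_prob e R i j x * srw_step e R (x j) y * hit_prob e B C k y)%:E)%E.
  by rewrite EE IH path_prob_extend /extend ltnn.
rewrite (@measure_sum_fibers _ _ _ P _ (Y j.+1) (nbrs e (x j))) //.
- under eq_bigr do rewrite law.
  rewrite -ge0_sume_distrr; last first.
    move=> y _; rewrite lee_fin !mulr_ge0 ?hit_prob_ge0 //.
    - by case: ifP.
    - by apply: prodr_ge0 => r _; rewrite /srw_step; case: ifP.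
    - by rewrite /srw_step; case: ifP.
  congr (_ * _)%E; rewrite sumEFin; congr EFin.
  rewrite /mean !mulr_sumr big_seq [RHS]big_seq; apply: eq_bigr => y yx.
  by rewrite srw_stepE // yx mulrA.
- exact: nbrs_uniq.
- by move=> y yx; rewrite law srw_stepE // (negbTE yx) mulr0 mul0r mule0.
Qed.

(** The law of a walk prescribes the probabilities of its finite paths; splitting
    a hitting event along the next position turns them into the recursion that
    defines [hit_prob].  The set [H] stands for the conditioning event. *)
Lemma prob_walk_hits k : P (H `&` [set w | hits B C k (fun r => Y r w)]) =
  (P H * (#|T|%:R^-1 * \sum_v hit_prob e B C k (v, i))%:E)%E.
Proof.
set E := (X in P X).
have mE : measurable E by apply: measurableI => //; exact: (measurable_hits k 0).
have walk0 y : walk 0 (fun _ => y) = [set w | Y 0%N w = y].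
  apply/seteqP; split => w /=; first exact.
  by move=> yw r; rewrite leqn0 => /eqP ->.
have law y : P (E `&` [set w | Y 0%N w = y]) =
   (P H * ((if y.2 == i then #|T|%:R^-1 else 0) * hit_prob e B C k y)%:E)%E.
  have := hits_after k 0 (fun _ => y).
  rewrite /srw_path_prob big_ord0 mulr1 => <-; congr (P _).
  rewrite walk0 /E; apply/seteqP; split => w /=.
    by move=> [[? ?] ?].
  by move=> [[? ?] ?].
rewrite (@measure_sum_fibers _ _ _ P _ (Y 0%N) [seq (v, i) | v <- enum T]) //.
- under eq_bigr do rewrite law.
  rewrite -ge0_sume_distrr; last first.
    by move=> y _; rewrite lee_fin !mulr_ge0 ?hit_prob_ge0 //; case: ifP.
  congr (_ * _)%E; rewrite sumEFin; congr EFin.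
  rewrite big_map big_enum mulr_sumr; apply: eq_bigr => v _ /=.
  by rewrite eqxx.
- by rewrite map_inj_uniq ?enum_uniq // => v v' [].
- move=> [v j] vj; rewrite law /=; case: eqP => [ji|]; last first.
    by rewrite mul0r mule0.
  by case/mapP: vj; exists v; rewrite ?mem_enum // ji.
Qed.

End WalkHits.

(** * Clusters, the front, and measurability of the process *)

Section Clusters.
Context {T : finType} (e : rel T).
Implicit Types (A : set (T * nat)) (x : nat -> T * nat).

Definition meets A (j : nat) : Prop := exists v, A (v, j).

(** The invariants of the process.  No layer is skipped, so every layer below the
    front is met and none from the front upwards is. *)
Record cluster (N : nat) A : Prop := Cluster {
  cluster_layer0 : layer 0 `<=` A;
  cluster_height : forall y, A y -> (y.2 < N)%N;
  cluster_meets : forall i j, (i <= j)%N -> meets A j -> meets A i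
}.

Lemma meetsP A j : layer j `&` A <> set0 <-> meets A j.
Proof.
split=> [/eqP/set0P[[v i] [/= <- Av]]|[v Av] /seteqP[h _]]; first by exists v.
exact: (h (v, j)).
Qed.

Lemma first_empty_layerP N A : cluster N A ->
  [/\ forall j, (j < first_empty_layer A)%N -> meets A j,
      ~ meets A (first_empty_layer A),
      forall y, A y -> (y.2 < first_empty_layer A)%N &
      (first_empty_layer A <= N)%N].
Proof.
move=> cA.
have empty_N : ~ meets A N.
  by move=> [v /(cluster_height cA)] /=; rewrite ltnn.
have ex : exists n, `[< ~ meets A n >] by exists N; apply/asboolP.
have first : [set i | layer i `&` A = set0 /\
    forall j, (j < i)%N -> layer j `&` A <> set0] (first_empty_layer A).
  rewrite /first_empty_layer; case: xgetP => [_ -> //|none].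
  exfalso; case: (ex_minnP ex) => n /asboolP An nmin; apply: (none n); split.
    by apply: contrapT => /meetsP.
  move=> j jn; apply/meetsP; apply: contrapT => Aj.
  by have := nmin j; rewrite leqNgt jn => h; have := h (asboolT Aj).
have [M0 Mlt] := first.
have nM : ~ meets A (first_empty_layer A) by move/meetsP; exact.
have below y : A y -> (y.2 < first_empty_layer A)%N.
  rewrite ltnNge => Ay; apply/negP => My; apply: nM.
  by apply: (cluster_meets cA My); exists y.1; case: y Ay {My}.
split=> // [j jM|]; first by apply/meetsP; exact: Mlt.
by rewrite leqNgt; apply/negP => NM; apply: empty_N; apply/meetsP; exact: Mlt.
Qed.

Lemma first_empty_layer_gt0 N A : cluster N A -> (0 < #|T|)%N ->
  (0 < first_empty_layer A)%N.
Proof.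
move=> cA /card_gt0P[v _]; have [_ _ h _] := first_empty_layerP cA.
by apply: leq_trans (h (v, 0%N) _) => //; exact: (cluster_layer0 cA).
Qed.

Lemma first_empty_layer_eq N A i : cluster N A ->
  first_empty_layer A = i <-> ((forall j, (j < i)%N -> meets A j) /\ ~ meets A i).
Proof.
move=> /first_empty_layerP[below at_M _ _].
split=> [<-|[below_i at_i]]; first exact: conj below at_M.
case: (ltngtP (first_empty_layer A) i) => [lt|gt|//].
  by case: (at_M (below_i _ lt)).
by case: (at_i (below _ gt)).
Qed.

Lemma first_hit_unique x (B : set (T * nat)) r s :
  first_hit x B r -> first_hit x B s -> r = s.
Proof.
move=> [Br r1] [Bs s1]; case: (ltngtP r s) => [h|h|//].
  by case: (s1 _ h).
by case: (r1 _ h).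
Qed.

Lemma first_hit_exists x (B : set (T * nat)) r : B (x r) ->
  exists2 s, (s <= r)%N & first_hit x B s.
Proof.
move=> Br; have ex : exists n, `[< B (x n) >] by exists r; apply/asboolP.
case: (ex_minnP ex) => s /asboolP Bs smin.
exists s; first by apply: smin; apply/asboolP.
by split=> // q qs Bq; have := smin q (asboolT Bq); rewrite leqNgt qs.
Qed.

Lemma aggregate_new_unique A x y z : aggregate e A x y -> ~ A y ->
  aggregate e A x z -> ~ A z -> y = z.
Proof.
move=> [//|[r hr ->]] _ [//|[s hs ->]] _.
by rewrite (first_hit_unique hr hs).
Qed.

Lemma boundary_height A y : boundary e A y ->
  exists2 z, A z & (y.2 <= z.2.+1)%N.
Proof.
by move=> [_ [z Az yz]]; exists z => //; move: yz; rewrite /cyl_adj; lia.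
Qed.

Lemma cluster_aggregate N A x : cluster N A -> cluster N.+1 (aggregate e A x).
Proof.
move=> cA; split=> [y y0|y|i j ij].
- by left; exact: (cluster_layer0 cA).
- case=> [/(cluster_height cA)|[r [/boundary_height[z Az yz] _] ->]].
    by move=> h; exact: ltnW.
  by apply: leq_ltn_trans yz _; rewrite ltnS; exact: (cluster_height cA).
- case=> v [Av|[r hr vj]].
    have [|w Aw] := cluster_meets cA ij; first by exists v.
    by exists w; left.
  have [ij'|ij'] := eqVneq i j.
    by exists v; right; exists r; rewrite // ij'.
  have [[z1 z2] Az zj] := boundary_height hr.1.
  have [||w Aw] := @cluster_meets _ _ cA i z2; last by exists w; left.
    by move: zj; rewrite -vj /=; lia.
  by exists z1.
Qed.

Lemma cluster0 : cluster 1 (layer 0 : set (T * nat)).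
Proof.
split=> [//|y -> //|i j ij [v vj]]; exists v.
by move: vj ij; rewrite /layer /= => ->; rewrite leqn0 => /eqP.
Qed.

(** Above the layer just below the front there is no cluster, so the boundary at
    these heights lies on the front itself: a particle that reaches [u] without
    descending below the front must have settled on the front, on [u] or
    earlier. *)
Lemma hits_above_fills N A x u k : cluster N A ->
  A (u, (first_empty_layer A).-1) -> (0 < #|T|)%N ->
  hits (pred1 (u, first_empty_layer A))
       (fun y => (y.2 < first_empty_layer A)%N) k x ->
  meets (aggregate e A x) (first_empty_layer A).
Proof.
move=> cA Au T0 /hitsP[r [_ /= /eqP xr above]].
have M0 := first_empty_layer_gt0 cA T0.
have [_ nM below _] := first_empty_layerP cA.
set M := first_empty_layer A in M0 nM below above xr Au *.
have bxr : boundary e A (x r).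
  rewrite xr; split=> [/below /=|]; first by rewrite ltnn.
  exists (u, M.-1) => //; rewrite /cyl_adj /= eqxx andbT.
  by apply/orP; right; rewrite prednK // eqxx.
have [s sr hs] := first_hit_exists bxr.
have sM : (x s).2 = M.
  apply/eqP; rewrite eqn_leq; apply/andP; split.
    by have [z /below zM zs] := boundary_height hs.1; apply: leq_trans zs _.
  rewrite leqNgt; move: sr; rewrite leq_eqVlt => /orP[/eqP ->|/above //].
  by rewrite xr ltnn.
by exists (x s).1; right; exists s => //; rewrite -sM; case: (x s).
Qed.

Lemma landing_hits A x m y : aggregate e A x y -> ~ A y -> (y.2 <= m)%N ->
  exists k, hits (fun z => (z.2 <= m)%N) (fun z => `[< boundary e A z >]) k x.
Proof.
move=> [//|[r [br first] ->]] _ ym; exists r; apply/hitsP; exists r; split=> // q qr.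
by apply/asboolP; exact: first.
Qed.

End Clusters.

Section PredicateMeasurability.
Context {d : measure_display} {Omega : measurableType d}.

(** Events written as predicates, so that measurability follows the shape of the
    formula defining the event. *)
Definition measurable_event (Q : Omega -> Prop) := measurable [set w | Q w].

Lemma measurable_event_const (Q : Prop) : measurable_event (fun _ => Q).
Proof.
rewrite /measurable_event; have [q|q] := pselect Q.
  by rewrite (_ : [set _ | _] = setT) //; apply/seteqP; split.
by rewrite (_ : [set _ | _] = set0) //; apply/seteqP; split.
Qed.

Lemma measurable_event_not Q : measurable_event Q ->
  measurable_event (fun w => ~ Q w).
Proof. exact: measurableC. Qed.

Lemma measurable_event_and Q1 Q2 : measurable_event Q1 -> measurable_event Q2 ->
  measurable_event (fun w => Q1 w /\ Q2 w).
Proof. exact: measurableI. Qed.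

Lemma measurable_event_or Q1 Q2 : measurable_event Q1 -> measurable_event Q2 ->
  measurable_event (fun w => Q1 w \/ Q2 w).
Proof. exact: measurableU. Qed.

Lemma measurable_event_exists (I : countType) (Q : I -> Omega -> Prop) :
  (forall i, measurable_event (Q i)) -> measurable_event (fun w => exists i, Q i w).
Proof.
move=> mQ; rewrite /measurable_event (_ : [set w | _] = \bigcup_i [set w | Q i w]).
  exact: countable_bigcupT_measurable.
by apply/seteqP; split => w [i]; [exists i | move=> _ ?; exists i].
Qed.

Lemma measurable_event_forall (I : countType) (Q : I -> Omega -> Prop) :
  (forall i, measurable_event (Q i)) -> measurable_event (fun w => forall i, Q i w).
Proof.
move=> mQ; rewrite (_ : (fun w => _) = fun w => ~ exists i, ~ Q i w).
  apply/measurable_event_not/measurable_event_exists => i.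
  exact: measurable_event_not.
apply/funext => w; apply/propext; split => [h [i]|h i]; first by apply; exact: h.
by apply: contrapT => q; apply: h; exists i.
Qed.

Lemma measurable_event_implies (Q1 : Prop) Q2 : (Q1 -> measurable_event Q2) ->
  measurable_event (fun w => Q1 -> Q2 w).
Proof.
move=> mQ; have [q|q] := pselect Q1.
  rewrite (_ : (fun w => _) = Q2); first exact: mQ.
  by apply/funext => w; apply/propext; split=> [/(_ q)|].
rewrite (_ : (fun w => _) = fun=> True); first exact: measurable_event_const.
by apply/funext => w; apply/propext; split.
Qed.

End PredicateMeasurability.

Section DLA.
Context {R : realType} {T : finType} (e : rel T).
Context {d : measure_display} {Omega : measurableType d}.
Variable P : probability Omega R.
Variables (X : nat -> nat -> Omega -> T * nat) (A : nat -> Omega -> set (T * nat)).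
Hypothesis HA : cylinder_DLA e P X A.

Lemma DLA_cluster t w : cluster t.+1 (A t w).
Proof.
elim: t => [|t IH]; first by rewrite (DLA_init HA); exact: cluster0.
by rewrite (DLA_next HA); exact: cluster_aggregate.
Qed.

Lemma DLA_mono s t w : (s <= t)%N -> A s w `<=` A t w.
Proof.
move=> /subnK <-; elim: (t - s)%N => [//|k IH] y /IH Ay.
by rewrite addSn (DLA_next HA); left.
Qed.

(** Membership in the next cluster is a countable combination of membership in the
    current one and of the positions of the walk. *)
Lemma measurable_DLA t y : measurable_event (fun w => A t w y).
Proof.
elim: t y => [|t IH] y.
  rewrite (_ : (fun w => _) = fun=> layer 0 y); first exact: measurable_event_const.
  by apply/funext => w; rewrite (DLA_init HA).
have mbd z : measurable_event (fun w => boundary e (A t w) z).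
  apply: measurable_event_and; first exact: measurable_event_not.
  rewrite (_ : (fun w => _) = fun w => exists z', A t w z' /\ cyl_adj e z z').
    apply: measurable_event_exists => z'.
    apply: measurable_event_and => //; exact: measurable_event_const.
  apply/funext => w; apply/propext; split=> [[z' ? ?]|[z' [? ?]]]; by exists z'.
have mX r z : measurable_event (fun w => X t r w = z) by exact: (DLA_measurable HA).
have mbX r : measurable_event (fun w => boundary e (A t w) (X t r w)).
  rewrite (_ : (fun w => _) = fun w => exists z, X t r w = z /\ boundary e (A t w) z).
    by apply: measurable_event_exists => z; exact: measurable_event_and.
  by apply/funext => w; apply/propext; split=> [?|[z [-> //]]]; exists (X t r w).
rewrite (_ : (fun w => _) = fun w => A t w y \/ exists r,
    (boundary e (A t w) (X t r w) /\
      forall q, (q < r)%N -> ~ boundary e (A t w) (X t q w)) /\ X t r w = y).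
  apply: measurable_event_or => //; apply: measurable_event_exists => r.
  apply: measurable_event_and => //; apply: measurable_event_and => //.
  apply: measurable_event_forall => q; apply: measurable_event_implies => _.
  exact: measurable_event_not.
apply/funext => w; rewrite (DLA_next HA); apply/propext; split.
  by case=> [?|[r ? ->]]; [left | right; exists r].
by case=> [?|[r [? <-]]]; [left | right; exists r].
Qed.

Lemma measurable_DLA_meets t i : measurable_event (fun w => meets (A t w) i).
Proof. by apply: measurable_event_exists => v; exact: measurable_DLA. Qed.

Lemma measurable_first_empty_layer t i :
  measurable_event (fun w => first_empty_layer (A t w) = i).
Proof.
rewrite (_ : (fun w => _) = fun w =>
    (forall j, (j < i)%N -> meets (A t w) j) /\ ~ meets (A t w) i).
  apply: measurable_event_and.
    apply: measurable_event_forall => j; apply: measurable_event_implies => _.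
    exact: measurable_DLA_meets.
  by apply: measurable_event_not; exact: measurable_DLA_meets.
by apply/funext => w; apply/propext; exact: (first_empty_layer_eq _ (DLA_cluster t w)).
Qed.

Definition past (t : nat) (a : nat -> set (T * nat)) : set Omega :=
  [set w | forall s, (s <= t)%N -> A s w = a s].

Lemma measurable_past t a : measurable (past t a).
Proof.
suff : measurable_event (past t a) by [].
apply: measurable_event_forall => s; apply: measurable_event_implies => _.
rewrite (_ : (fun w => _) = fun w => forall y, A s w y <-> a s y).
  apply: measurable_event_forall => y; apply: measurable_event_and.
    rewrite (_ : (fun w => _) = fun w => ~ A s w y \/ a s y).
      apply: measurable_event_or; last exact: measurable_event_const.
      by apply: measurable_event_not; exact: measurable_DLA.
    by apply/funext => w; apply/propext; rewrite implyE.
  by apply: measurable_event_implies => _; exact: measurable_DLA.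
apply/funext => w; apply/propext; split=> [-> //|h].
by apply/funext => y; apply/propext.
Qed.

(** Clusters are finite sets, so the whole past takes countably many values and
    can be conditioned upon value by value. *)
Definition history (t : nat) (w : Omega) : seq {fset T * nat} :=
  [seq fset_set (A s w) | s <- iota 0 t.+1].

Lemma DLA_finite t w : finite_set (A t w).
Proof.
apply: (@sub_finite_set _ _ ([set: T] `*` `I_t.+1)); last first.
  by apply: finite_setX; [exact: finite_finset | exact: finite_II].
by move=> y /(cluster_height (DLA_cluster t w)); split.
Qed.

Lemma history_fiber t w0 :
  [set w | history t w = history t w0] = past t (fun s => A s w0).
Proof.
apply/seteqP; split => w /=; rewrite /history; last first.
  by move=> h; apply/eq_in_map => s; rewrite mem_iota ltnS => /h ->.
move=> /eq_in_map h s st; have := h s; rewrite mem_iota ltnS => /(_ st) hs.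
by apply: fset_set_inj hs; exact: DLA_finite.
Qed.

Lemma measurable_history t z : measurable [set w | history t w = z].
Proof.
have [[w0 <-]|nz] := pselect (exists w0, history t w0 = z).
  by rewrite history_fiber; exact: measurable_past.
rewrite (_ : [set w | _] = set0) //.
by apply/seteqP; split => // w hw; apply: nz; exists w.
Qed.

End DLA.

(** * One particle: settling low against moving the front *)

Section Regularity.
Context {T : finType} (e : rel T).

(** An automorphism maps the neighbourhood of a vertex onto that of its image. *)
Lemma vertex_transitive_regular u v : vertex_transitive e -> #|e u| = #|e v|.
Proof.
move=> /(_ u v)[f [fe fu]]; rewrite -fu -(card_imset (mem (e u)) (@perm_inj _ f)).
apply: eq_card => x; apply/imsetP/idP => [[y uy ->]|ux].
  by rewrite unfold_in /= fe.
exists (f^-1%g x); last by rewrite permKV.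
by rewrite unfold_in /= -fe permKV.
Qed.

Lemma connected_degree_gt0 v : connected_graph e -> (1 < #|T|)%N -> (0 < #|e v|)%N.
Proof.
move=> conn T2; have [u uv] : exists u, u != v.
  have : (0 < #|predC1 v|)%N by rewrite (cardC1 v); lia.
  by case/card_gt0P => u; exists u.
have [[|g p] /= vp uE] := connectP (conn v u); first by rewrite uE eqxx in uv.
by apply/card_gt0P; exists g; case/andP: vp.
Qed.

End Regularity.

Section OneStep.
Context {R : realType} {T : finType} (e : rel T).
Hypotheses (e_sym : symmetric e) (e_irr : irreflexive e).
Hypothesis e_conn : connected_graph e.
Variable deg : nat.
Hypotheses (e_reg : forall v, #|e v| = deg) (deg_gt0 : (0 < deg)%N).
Hypothesis T_gt0 : (0 < #|T|)%N.
Context {d : measure_display} {Omega : measurableType d}.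
Variable P : probability Omega R.
Variables (X : nat -> nat -> Omega -> T * nat) (A : nat -> Omega -> set (T * nat)).
Hypothesis HA : cylinder_DLA e P X A.

(** Layer 0 is full from the start, so a new vertex of height at most [m] lies in
    one of the layers [1], ..., [m]. *)
Definition lands_below (m t : nat) (w : Omega) : Prop :=
  exists y, [/\ A t.+1 w y, ~ A t w y & (y.2 <= m)%N].

Lemma measurable_lands_below m t : measurable_event (lands_below m t).
Proof.
rewrite (_ : lands_below m t = fun w =>
    exists y, A t.+1 w y /\ (~ A t w y /\ (y.2 <= m)%N)).
  apply: measurable_event_exists => y; apply: measurable_event_and.
    exact: (measurable_DLA HA).
  apply: measurable_event_and; last exact: measurable_event_const.
  by apply: measurable_event_not; exact: (measurable_DLA HA).
by apply/funext => w; apply/propext; split=> [[y []]|[y [? []]]]; exists y.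
Qed.

Let front (t : nat) (w : Omega) := first_empty_layer (A t w).

Section GivenPast.
Variables (t : nat) (w0 : Omega).
Let H := past A t (fun s => A s w0).
Let i := front t w0.

Let i_gt0 : (0 < i)%N.
Proof. exact: first_empty_layer_gt0 (DLA_cluster HA t w0) T_gt0. Qed.

Let mH : measurable H.
Proof. exact: (measurable_past HA). Qed.

Let mX r x : measurable [set w | X t r w = x].
Proof. exact: (DLA_measurable HA). Qed.

Let law k x : P (H `&` [set w | forall r, (r <= k)%N -> X t r w = x r]) =
  (P H * (srw_path_prob e R i k x)%:E)%E.
Proof. exact: (DLA_walk HA t k (fun s => A s w0) x). Qed.

(** Landing at or below layer [m] forces the walk to reach height [m] before the
    boundary, within some finite time; continuity from below passes from bounded
    horizons to this event. *)
Lemma prob_lands_below m :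
  (P (H `&` [set w | lands_below m t w]) <=
   (decay_rate (R:=R) (T:=T) deg ^+ (i.-1 - m))%:E * P H)%E.
Proof.
set c := _ ^+ _.
pose B : pred (T * nat) := fun z => (z.2 <= m)%N.
pose C : pred (T * nat) := fun z => `[< boundary e (A t w0) z >].
pose F k := H `&` [set w | hits B C k (fun r => X t r w)].
have mF k : measurable (F k).
  by apply: measurableI => //; exact: (measurable_hits (Y := X t) mX B C k 0).
have F_mono : nondecreasing_seq F.
  apply/nondecreasing_seqP => k; apply/subsetPset => w [Hw /hitsP[r [rk Br Cr]]].
  by split=> //; apply/hitsP; exists r; split=> //; exact: leqW.
have FU : H `&` [set w | lands_below m t w] `<=` \bigcup_k F k.
  move=> w [Hw [y []]]; rewrite (DLA_next HA) => new old ym.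
  have [k hk] := landing_hits new old ym.
  exists k => //; split=> //=; move: hk; rewrite (Hw t) //.
have mU : measurable (\bigcup_k F k) by exact: bigcupT_measurable.
apply: (@le_trans _ _ (P (\bigcup_k F k))).
  apply: le_measure => //; rewrite inE //; apply: measurableI => //.
  exact: measurable_lands_below.
have Fcvg := nondecreasing_cvg_mu (mu := P) mF mU F_mono.
rewrite -(cvg_lim _ Fcvg) //; apply: lime_le; first by apply: cvgP Fcvg.
apply: nearW => k /=.
rewrite (prob_walk_hits mH mX law); last by move=> x; rewrite /B -ltnNge => + _; lia.
rewrite muleC lee_wpmul2r // lee_fin ler_pdivrMl ?ltr0n //.
rewrite mulr_natl -[#|T|]/(#|xpredT|) -sumr_const; apply: ler_sum => v _.
have [below at_i _ _] := first_empty_layerP (DLA_cluster HA t w0).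
apply: (hit_prob_deep (A := A t w0) (M := i) m e_reg e_conn) => [j ji|||].
- by apply/meetsP; exact: below.
- by rewrite prednK.
- by move=> Av; apply: at_i; exists v.
- exact: leq_pred.
Qed.

(** The constant is [3 / 2], the lower bound on the sum of hitting probabilities
    over the starting layer, times the probability [1 / #|T|] of each start. *)
Lemma prob_front_moves :
  (((3%:R / 2%:R) / #|T|%:R)%:E * P H <=
    P (H `&` [set w | meets (A t.+1 w) i]))%E.
Proof.
have [u Au] : meets (A t w0) i.-1.
  have [below _ _ _] := first_empty_layerP (DLA_cluster HA t w0).
  by apply: below; rewrite -/(front t w0) -/i prednK.
have [S S32 Scvg] := sum_hit_prob_above (R := R) e_sym e_irr e_reg deg_gt0 u i_gt0.
set B := pred1 (u, i) in Scvg; set C := (fun x => _ < i)%N in Scvg.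
have mE : measurable (H `&` [set w | meets (A t.+1 w) i]).
  by apply: measurableI => //; exact: (measurable_DLA_meets HA).
have fin E : measurable E -> P E \is a fin_num by move=> ?; exact: fin_num_measure.
have lower k : fine (P H) * (#|T|%:R^-1 * \sum_v hit_prob e B C k (v, i)) <=
    fine (P (H `&` [set w | meets (A t.+1 w) i])).
  rewrite -lee_fin EFinM !fineK ?fin //.
  rewrite -(prob_walk_hits mH mX law); last first.
    by move=> x _; rewrite /C -leqNgt; lia.
  apply: le_measure; rewrite ?inE //.
    by apply: measurableI => //; exact: (measurable_hits (Y := X t) mX B C k 0).
  move=> w [Hw hw]; split=> //=; rewrite (DLA_next HA).
  have HwE : A t w = A t w0 by exact: Hw.
  rewrite HwE; exact: (hits_above_fills e (DLA_cluster HA t w0) Au T_gt0 hw).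
rewrite -[P H]fineK ?fin // -[leRHS]fineK ?fin // -EFinM lee_fin.
apply: (@le_trans _ _ (fine (P H) * (#|T|%:R^-1 * S))).
  rewrite mulrC ler_wpM2l ?fine_ge0 //.
  by rewrite mulrC ler_wpM2l ?invr_ge0.
have cvgS : (fun k => fine (P H) * (#|T|%:R^-1 * \sum_v hit_prob e B C k (v, i)))
    @ \oo --> fine (P H) * (#|T|%:R^-1 * S).
  by apply: cvgMr; apply: cvgMr.
rewrite -(cvg_lim _ cvgS) //; apply: limr_le; first by apply: cvgP cvgS.
exact: nearW.
Qed.

End GivenPast.

(** On each history with front [i], the two preceding estimates bound the left
    event above and the right event below by multiples of the probability of the
    history; the quotient of these multiples is the constant. *)
Lemma lands_below_le_front_moves m t i :
  (P [set w | lands_below m t w /\ front t w = i] <=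
   ((2%:R / 3%:R * #|T|%:R) * decay_rate (R:=R) (T:=T) deg ^+ (i.-1 - m))%:E *
   P [set w | meets (A t.+1 w) i /\ front t w = i])%E.
Proof.
set c := decay_rate _ ^+ _.
have c0 : 0 <= c by rewrite exprn_ge0 ?decay_rate_ge0.
have mfront : measurable_event (fun w => front t w = i).
  exact: (measurable_first_empty_layer HA).
have mL := measurable_lands_below m t.
have mM := measurable_DLA_meets HA t.+1 i.
apply: (@measure_le_of_fibers _ _ _ P _ (history A t)).
- exact: (measurable_history HA).
- exact: measurable_event_and.
- exact: measurable_event_and.
move=> z; have [[w0 <-]|nz] := pselect (exists w0, history A t w0 = z); last first.
  rewrite (_ : [set w | _ = z] = set0); first by rewrite !setI0 measure0 mule0.
  by apply/seteqP; split => // w hw; apply: nz; exists w.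
rewrite (history_fiber HA); set H := past A t _.
have front_H w : H w -> front t w = front t w0.
  by move=> Hw; rewrite /front (Hw t).
have [iE|iE] := eqVneq (front t w0) i; last first.
  rewrite (_ : _ `&` H = set0); last first.
    apply/seteqP; split => // w [[_ /= wi] /front_H wH].
    by move: iE; rewrite -wH wi eqxx.
  by rewrite measure0 mule_ge0 // lee_fin !mulr_ge0 ?divr_ge0.
have restrict Q : [set w | Q w /\ front t w = i] `&` H = H `&` [set w | Q w].
  apply/seteqP; split => w /=; first by move=> [[? ?] ?].
  by move=> [Hw Qw]; rewrite (front_H _ Hw).
rewrite !restrict -/H.
apply: (le_trans (prob_lands_below t w0 m)); rewrite -/H iE -/c.
apply: (@le_trans _ _ (((2%:R / 3%:R * #|T|%:R) * c)%:E *
    (((3%:R / 2%:R) / #|T|%:R)%:E * P H))%E).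
  rewrite muleA -EFinM lee_wpmul2r // lee_fin.
  rewrite [leRHS](_ : _ = c) //; field.
  by rewrite pnatr_eq0 -lt0n.
rewrite lee_wpmul2l ?lee_fin ?mulr_ge0 ?divr_ge0 //.
by have := prob_front_moves t w0; rewrite iE.
Qed.

End OneStep.

(** * Summing over particles, and the density *)

Section RealProbability.
Context {R : realType} {d : measure_display} {Omega : measurableType d}.
Variable P : probability Omega R.
Implicit Types Q : Omega -> Prop.

Definition pr Q : R := fine (P [set w | Q w]).

Lemma prE Q : measurable_event Q -> P [set w | Q w] = (pr Q)%:E.
Proof. by move=> mQ; rewrite fineK ?fin_num_measure. Qed.

Lemma pr_ge0 Q : 0 <= pr Q.
Proof. exact: fine_ge0. Qed.

Lemma pr_le1 Q : measurable_event Q -> pr Q <= 1.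
Proof. by move=> mQ; rewrite -lee_fin -prE // probability_le1. Qed.

Lemma pr_le Q1 Q2 : measurable_event Q1 -> measurable_event Q2 ->
  (forall w, Q1 w -> Q2 w) -> pr Q1 <= pr Q2.
Proof.
move=> m1 m2 Q12; rewrite -lee_fin -!prE //; apply: le_measure; rewrite ?inE //.
Qed.

Lemma pr_diff Q1 Q2 : measurable_event Q1 -> measurable_event Q2 ->
  (forall w, Q1 w -> Q2 w) -> pr (fun w => Q2 w /\ ~ Q1 w) = pr Q2 - pr Q1.
Proof.
move=> m1 m2 Q12; have m21 : measurable_event (fun w => Q2 w /\ ~ Q1 w).
  by apply: measurable_event_and => //; exact: measurable_event_not.
apply/eqP; rewrite eq_sym subr_eq; apply/eqP; apply: EFin_inj.
rewrite EFinD -!prE // (measureDI P m2 m1); congr (P _ + P _)%E.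
exact/setIidr.
Qed.

(** Used with [G y] the event that the particle settles at [y]. *)
Lemma sum_pr_disjoint_le (I : eqType) (s : seq I) (G : I -> Omega -> Prop) Q :
  uniq s -> (forall y, measurable_event (G y)) -> measurable_event Q ->
  (forall y w, y \in s -> G y w -> Q w) ->
  (forall y z w, G y w -> G z w -> y = z) ->
  \sum_(y <- s) pr (G y) <= pr Q.
Proof.
move=> + mG + + Gdisj; elim: s Q => [|y s IH] Q /=.
  by move=> *; rewrite big_nil pr_ge0.
move=> /andP[ys us] mQ GQ; rewrite big_cons -lerBrDl.
have Gy_Q w : G y w -> Q w by apply: GQ; rewrite mem_head.
rewrite -pr_diff //; apply: IH => //.
  by apply: measurable_event_and => //; exact: measurable_event_not.
move=> z w zs Gz; split; first by apply: (GQ z) => //; rewrite in_cons zs orbT.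
by move=> Gy; move: ys; rewrite (Gdisj _ _ _ Gy Gz) zs.
Qed.

End RealProbability.

Section GeometricTail.
Context {R : realType} (rho : R).
Hypotheses (rho_ge0 : 0 <= rho) (rho_lt1 : rho < 1).

(** The first [m + 1] terms are 1 because the subtraction is truncated, and the
    others form a geometric series. *)
Lemma sum_truncated_geometric m K :
  \sum_(i < K) rho ^+ (i.-1 - m) <= m.+1%:R + (1 - rho)^-1.
Proof.
have geometric : \sum_(j < K) rho ^+ j <= (1 - rho)^-1.
  rewrite -[leRHS]mul1r ler_pdivlMr ?subr_gt0 // mulrC -opprB mulNr -subrX1.
  by rewrite opprB lerBlDr lerDl exprn_ge0.
apply: (@le_trans _ _ (\sum_(i < m.+1 + K) rho ^+ (i.-1 - m))).
  rewrite -!(big_mkord xpredT (fun i => rho ^+ (i.-1 - m))).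
  rewrite [leRHS](big_cat_nat (n := K)) ?leq_addl //= lerDl.
  by apply: sumr_ge0 => i _; rewrite exprn_ge0.
rewrite big_split_ord lerD //=.
  rewrite -[X in _ <= X%:R](card_ord m.+1) -sumr_const; apply: ler_sum => i _.
  by rewrite (_ : i.-1 - m = 0)%N ?expr0 //; have := ltn_ord i; lia.
apply: le_trans geometric; apply: ler_sum => j _.
by rewrite (_ : (m.+1 + j).-1 - m = j)%N //; lia.
Qed.

End GeometricTail.

Section Density.
Context {R : realType} {T : finType} (e : rel T).
Hypotheses (e_sym : symmetric e) (e_irr : irreflexive e).
Hypothesis e_conn : connected_graph e.
Variable deg : nat.
Hypotheses (e_reg : forall v, #|e v| = deg) (deg_gt0 : (0 < deg)%N).
Hypothesis T_gt0 : (0 < #|T|)%N.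
Context {d : measure_display} {Omega : measurableType d}.
Variable P : probability Omega R.
Variables (X : nat -> nat -> Omega -> T * nat) (A : nat -> Omega -> set (T * nat)).
Hypothesis HA : cylinder_DLA e P X A.

Let rho : R := decay_rate (T := T) deg.
Let weight m i : R := 2%:R / 3%:R * #|T|%:R * rho ^+ (i.-1 - m).
Let reached i t : R := pr P (fun w => meets (A t w) i).

Let weight_ge0 m i : 0 <= weight m i.
Proof. by rewrite !mulr_ge0 ?divr_ge0 ?exprn_ge0 ?decay_rate_ge0. Qed.

(** The front moves from [i] to [i + 1] exactly when layer [i] is first reached,
    so the probability of this move is an increment of [reached i]. *)
Lemma pr_lands_below m t K : (t.+2 <= K)%N ->
  pr P (lands_below A m t) <=
  \sum_(i < K) weight m i * (reached i t.+1 - reached i t).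
Proof.
move=> tK; have mL := measurable_lands_below HA m t.
have mfront i := measurable_first_empty_layer HA t i.
have mM t' i := measurable_DLA_meets HA t' i.
have slice i : pr P (fun w => lands_below A m t w /\ first_empty_layer (A t w) = i)
    <= weight m i * (reached i t.+1 - reached i t).
  have mLi : measurable_event
      (fun w => lands_below A m t w /\ first_empty_layer (A t w) = i).
    exact: measurable_event_and.
  have mMi : measurable_event
      (fun w => meets (A t.+1 w) i /\ first_empty_layer (A t w) = i).
    exact: measurable_event_and.
  apply: (@le_trans _ _ (weight m i *
      pr P (fun w => meets (A t.+1 w) i /\ first_empty_layer (A t w) = i))).
    rewrite -lee_fin EFinM -!prE //.
    exact: (lands_below_le_front_moves e_sym e_irr e_conn e_reg deg_gt0 T_gt0 HA).
  rewrite ler_wpM2l // /reached -pr_diff //; last first.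
    by move=> w [v Av]; exists v; exact: (DLA_mono HA (leqnSn t)).
  apply: pr_le => //.
    by apply: measurable_event_and => //; exact: measurable_event_not.
  move=> w [Ai /(first_empty_layer_eq _ (DLA_cluster HA t w))[_ nAi]].
  by split.
have fib : P [set w | lands_below A m t w] =
   (\sum_(i <- iota 0 K) P ([set w | lands_below A m t w] `&`
      [set w | first_empty_layer (A t w) = i]))%E.
  apply: (measure_sum_fibers (Z := fun w => first_empty_layer (A t w))) => //.
    exact: iota_uniq.
  move=> i; rewrite mem_iota add0n => iK.
  rewrite (_ : _ `&` _ = set0) ?measure0 //.
  apply/seteqP; split => // w [_ /= wi]; move: iK; rewrite -wi.
  have [_ _ _ h] := first_empty_layerP (DLA_cluster HA t w).
  by rewrite (leq_ltn_trans h tK).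
rewrite -lee_fin -prE // fib -sumEFin -(big_mkord xpredT
  (fun i => (weight m i * (reached i t.+1 - reached i t))%:E)) /index_iota subn0.
apply: lee_sum => i _.
have mLi : measurable_event
    (fun w => lands_below A m t w /\ first_empty_layer (A t w) = i).
  exact: measurable_event_and.
by rewrite (_ : _ `&` _ =
  [set w | lands_below A m t w /\ first_empty_layer (A t w) = i]) // prE // lee_fin.
Qed.

(** The increments of [reached i] telescope to at most 1: the front pays the
    price [weight m i] only once for each layer. *)
Lemma sum_pr_lands_below m N :
  \sum_(0 <= t < N) pr P (lands_below A m t) <=
  2%:R / 3%:R * #|T|%:R * (m.+1%:R + (1 - rho)^-1).
Proof.
apply: (@le_trans _ _ (\sum_(0 <= t < N) \sum_(i < N.+1)
    weight m i * (reached i t.+1 - reached i t))).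
  rewrite big_nat [leRHS]big_nat; apply: ler_sum => t /andP[_ tN].
  exact: pr_lands_below.
rewrite exchange_big /=; apply: (@le_trans _ _ (\sum_(i < N.+1) weight m i)).
  apply: ler_sum => i _; rewrite -mulr_sumr telescope_sumr // ler_piMr //.
  rewrite lerBlDr (le_trans (pr_le1 P (measurable_DLA_meets HA N i))) //.
  by rewrite lerDl pr_ge0.
rewrite -mulr_sumr ler_wpM2l ?mulr_ge0 ?divr_ge0 //.
apply: sum_truncated_geometric; first exact: decay_rate_ge0.
exact: decay_rate_lt1.
Qed.

Let sites m : seq (T * nat) :=
  [seq (v, i) | i <- index_iota 1 m.+1, v <- enum T].

Let sites_uniq m : uniq (sites m).
Proof.
apply: allpairs_uniq; rewrite ?iota_uniq ?enum_uniq //.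
by move=> [i v] [j u] _ _ [-> ->].
Qed.

Let mem_sites m y : y \in sites m -> (0 < y.2 <= m)%N.
Proof. by move=> /allpairsP[[i v] /= [+ _ ->]]; rewrite mem_index_iota ltnS. Qed.

(** Each particle occupies at most one new vertex, so the expected number of
    occupied vertices is at most the expected number of particles that settle
    at or below layer [m]. *)
Lemma sum_pr_cluster m N :
  \sum_(y <- sites m) pr P (fun w => A N w y) <=
  2%:R / 3%:R * #|T|%:R * (m.+1%:R + (1 - rho)^-1).
Proof.
apply: le_trans (sum_pr_lands_below m N).
have grow t y : pr P (fun w => A t.+1 w y) - pr P (fun w => A t w y) =
    pr P (fun w => A t.+1 w y /\ ~ A t w y).
  rewrite -pr_diff //; [exact: (measurable_DLA HA)..|].
  by move=> w; exact: (DLA_mono HA (leqnSn t)).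
rewrite (eq_big_seq (fun y => \sum_(0 <= t < N)
    pr P (fun w => A t.+1 w y /\ ~ A t w y))) => [|y /mem_sites/andP[y0 _]].
  rewrite exchange_big /=; apply: ler_sum => t _.
  apply: sum_pr_disjoint_le => // [y||y w|y z w [y1 y2] [z1 z2]].
  - apply: measurable_event_and; first exact: (measurable_DLA HA).
    by apply: measurable_event_not; exact: (measurable_DLA HA).
  - exact: (measurable_lands_below HA).
  - by move=> /mem_sites/andP[_ ym] [? ?]; exists y.
  - move: y1 z1; rewrite !(DLA_next HA) => y1 z1.
    exact: aggregate_new_unique y1 y2 z1 z2.
under [RHS]eq_bigr do rewrite -grow.
rewrite telescope_sumr // [X in _ - X](_ : _ = 0) ?subr0 //.
rewrite /pr (_ : [set w | _] = set0) ?measure0 //.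
apply/seteqP; split => // w /=; rewrite (DLA_init HA) /layer /= => yE.
by rewrite yE in y0.
Qed.

Let measurable_final y : measurable_event (fun w => final_cluster A w y).
Proof.
rewrite (_ : (fun w => _) = fun w => exists t, A t w y).
  by apply: measurable_event_exists => t; exact: (measurable_DLA HA).
by apply/funext => w; apply/propext; split=> [[t _ ?]|[t ?]]; exists t.
Qed.

Lemma sum_pr_final_cluster m :
  \sum_(y <- sites m) pr P (fun w => final_cluster A w y) <=
  2%:R / 3%:R * #|T|%:R * (m.+1%:R + (1 - rho)^-1).
Proof.
have cvg_final y :
    (fun N => pr P (fun w => A N w y)) @ \oo --> pr P (fun w => final_cluster A w y).
  have FE : [set w | final_cluster A w y] = \bigcup_N [set w | A N w y] by [].
  apply: fine_cvg; rewrite -prE // FE.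
  apply: nondecreasing_cvg_mu => [N||].
  - exact: (measurable_DLA HA).
  - by rewrite -FE; exact: measurable_final.
  - apply/nondecreasing_seqP => N; apply/subsetPset => w.
    exact: (DLA_mono HA (leqnSn N)).
have cvg_sum : (fun N => \sum_(y <- sites m) pr P (fun w => A N w y)) @ \oo -->
    \sum_(y <- sites m) pr P (fun w => final_cluster A w y).
  by apply: cvg_big => [|y _]; [exact: add_continuous | exact: cvg_final].
rewrite -(cvg_lim _ cvg_sum) //; apply: limr_le; first by apply: cvgP cvg_sum.
by apply: nearW => N; exact: sum_pr_cluster.
Qed.

Let density_uptoE m w : density_upto R A m w =
  \sum_(y <- sites m) (m * #|T|)%:R^-1 * \1_[set w | final_cluster A w y] w.
Proof.
rewrite -mulr_sumr /density_upto big_allpairs_dep; congr (_ * _).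
apply: eq_bigr => i _; rewrite /layer_count -sum1_card natr_sum big_enum /=.
rewrite big_mkcond; apply: eq_bigr => v _; rewrite indicE.
rewrite (_ : (v \in _) = `[< final_cluster A w (v, i) >]); last first.
  by apply/idP/idP => [/set_mem|h]; last exact: mem_set.
by case: asboolP => h; [rewrite mem_set | rewrite memNset].
Qed.

Lemma measurable_density_upto m : measurable_fun setT (density_upto R A m).
Proof.
rewrite (_ : density_upto R A m = fun w => \sum_(y <- sites m)
    (m * #|T|)%:R^-1 * \1_[set w | final_cluster A w y] w).
  apply: measurable_sum => y; apply: measurable_funM => //.
  exact: measurable_indic (measurable_final y).
by apply/funext => w; exact: density_uptoE.
Qed.

Lemma density_upto_ge0 m w : 0 <= density_upto R A m w.
Proof.
by rewrite density_uptoE; apply: sumr_ge0 => y _; rewrite mulr_ge0 ?invr_ge0.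
Qed.

Lemma density_upto_le1 m w : density_upto R A m w <= 1.
Proof.
rewrite /density_upto; have [->|m0] := eqVneq m 0%N.
  by rewrite mul0n invr0 mul0r.
have mT : (0 < m * #|T|)%N by rewrite muln_gt0 lt0n m0.
rewrite ler_pdivrMl ?ltr0n // mulr1 -natr_sum ler_nat.
apply: (@leq_trans (\sum_(1 <= i < m.+1) #|T|)).
  by apply: leq_sum => i _; rewrite /layer_count max_card.
by rewrite sum_nat_const_nat subn1.
Qed.

Lemma mean_density_upto m : (0 < m)%N ->
  (\int[P]_w (density_upto R A m w)%:E <=
   (2%:R / 3%:R * (1 + (1 + (1 - rho)^-1) * m%:R^-1))%:E)%E.
Proof.
move=> m0; under eq_integral do rewrite density_uptoE -sumEFin.
rewrite ge0_integral_sum //.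
- have -> : (\sum_(y <- sites m) \int[P]_w
      ((m * #|T|)%:R^-1 * \1_[set w | final_cluster A w y] w)%:E)%E =
    ((m * #|T|)%:R^-1 *
      \sum_(y <- sites m) pr P (fun w => final_cluster A w y))%:E.
    rewrite mulr_sumr -sumEFin; apply: eq_bigr => y _.
    under eq_integral do rewrite EFinM.
    rewrite ge0_integralZl_EFin ?invr_ge0 //.
    + rewrite integral_indic ?setIT //; last exact: measurable_final.
      by rewrite EFinM; congr (_ * _)%E; exact: (prE P (measurable_final y)).
    + by apply/measurable_EFinP; apply: measurable_indic; exact: measurable_final.
  rewrite lee_fin ler_pdivrMl ?ltr0n ?muln_gt0 ?m0 //.
  apply: le_trans (sum_pr_final_cluster m) _.
  rewrite natrM -natr1 le_eqVlt; apply/orP; left; apply/eqP.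
  set c := (1 - rho)^-1; field.
  by rewrite pnatr_eq0 -lt0n.
- move=> y; apply/measurable_EFinP; apply: measurable_funM => //.
  by apply: measurable_indic; exact: measurable_final.
Qed.

(** Densities are bounded by 1, so almost sure convergence to the constant [D]
    carries over to their means. *)
Lemma density_le_two_thirds D : density_at_infinity P A D -> D <= 2%:R / 3%:R.
Proof.
move=> HD.
have dominated : (fun m => \int[P]_w (density_upto R A m w)%:E)%E @ \oo --> D%:E.
  have [|||||_ _ +] := @dominated_convergence _ _ _ P setT measurableT
      (fun m w => (density_upto R A m w)%:E) (fun=> D%:E) (cst 1%E).
  - by move=> m; apply/measurable_EFinP; exact: measurable_density_upto.
  - exact: measurable_cst.
  - apply: filterS HD => w Dw _; apply: cvg_EFin; last exact: Dw.
    exact: nearW.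
  - exact: finite_measure_integrable_cst.
  - apply: aeW => w m _; rewrite abse_EFin lee_fin ger0_norm.
      exact: density_upto_le1.
    exact: density_upto_ge0.
  - have PT : P [set: Omega] = 1%E by exact: probability_setT.
    by rewrite integral_cst // [X in (_ * X)%E]PT mule1.
pose bound k : R := 2%:R / 3%:R * (1 + (1 + (1 - rho)^-1) * harmonic k).
have bound_cvg : (EFin \o bound) @ \oo --> (2%:R / 3%:R : R)%:E.
  apply: cvg_EFin; first exact: nearW.
  rewrite -[X in _ --> X]mulr1; apply: cvgMr.
  rewrite -[X in _ --> X]addr0; apply: cvgD; first exact: cvg_cst.
  rewrite -(mulr0 (1 + (1 - rho)^-1)); apply: cvgMr; exact: cvg_harmonic.
rewrite -lee_fin -(cvg_lim _ bound_cvg) //.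
have shifted : (fun k => \int[P]_w (density_upto R A k.+1 w)%:E)%E @ \oo --> D%:E.
  by rewrite (cvg_shiftS (fun m => \int[P]_w (density_upto R A m w)%:E)%E).
rewrite -(cvg_lim _ shifted) //.
apply: lee_lim; [exact: cvgP shifted | exact: cvgP bound_cvg |].
by apply: nearW => k; exact: mean_density_upto.
Qed.

End Density.

Theorem theorem4p6 (R : realType) (T : finType) (e : rel T)
  (He_simple : simple_graph e) (He_conn : connected_graph e)
  (HT : (1 < #|T|)%N) (He_trans : vertex_transitive e)
  (d : measure_display) (Omega : measurableType d) (P : probability Omega R)
  (X : nat -> nat -> Omega -> T * nat) (A : nat -> Omega -> set (T * nat))
  (HA : cylinder_DLA e P X A)
  (D : R) (HD : density_at_infinity P A D) :
  D <= 2%:R / 3%:R.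
Proof.
have [e_sym e_irr] := He_simple.
have [v _] : exists v, v \in T by apply/card_gt0P; exact: ltnW.
have e_reg u : #|e u| = #|e v| by exact: vertex_transitive_regular.
have deg_gt0 := connected_degree_gt0 v He_conn HT.
exact: (density_le_two_thirds e_sym e_irr He_conn e_reg deg_gt0 (ltnW HT) HA HD).
Qed.
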